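(* Let $T$ be a positive theory with the joint embedding property in a single-sorted signature $L$ with monster model $\mathfrak M$, let $\mathcal E$ be a set of partial types as described in the context, and let $T^{\mathcal E}$ be the corresponding hyperimaginary theory. Then $T$ is NSOP$_1$ if and only if $T^{\mathcal E}$ is NSOP$_1$.
   Context: Positive logic: ''formula'' means positive existential formula (built from atomic formulas using $\wedge,\vee,\top,\bot,\exists$); a theory is a set of h-inductive sentences $\forall x(\varphi(x)\to\psi(x))$ with $\varphi,\psi$ positive existential; one works in a monster model (a very saturated, very homogeneous existentially closed model). SOP$_1$: a formula $\varphi(x,y)$ (possibly multi-sorted) has SOP$_1$ in a theory $T$ if there are a formula $\psi(y_1,y_2)$ and parameters $(a_\eta)_{\eta\in2^{<\omega}}$ in the monster such that (i) for every $\sigma\in2^\omega$ the set $\{\varphi(x,a_{\sigma|n}):n<\omega\}$ is consistent; (ii) $T\models\forall y_1y_2\neg[\psi(y_1,y_2)\wedge\exists x(\varphi(x,y_1)\wedge\varphi(x,y_2))]$; (iii) $\models\psi(a_{\eta^\frown1},a_\nu)$ whenever $\eta^\frown0\preceq\nu$. $T$ is NSOP$_1$ if no formula has SOP$_1$. Hyperimaginary extension: let $\mathcal E$ be a set of partial types $E(x,y)$ over $\emptyset$ ($x,y$ small tuples of the same length) each defining an equivalence relation on tuples of $\mathfrak M$. $L_{\mathcal E}$ is the multi-sorted signature with the real sort (carrying $L$), a sort $S_E$ for each $E\in\mathcal E$, and for all $E_1,\dots,E_n\in\mathcal E$ and each $L$-formula $\varphi(x,y_1,\dots,y_n)$ ($y_j$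 real tuples matching $E_j$) a relation symbol $R_\varphi(x,z_1,\dots,z_n)$ with $z_j$ of sort $S_{E_j}$. $\mathfrak M^{\mathcal E}$ has real sort $\mathfrak M$, sort $S_E$ the $E$-classes of tuples of $\mathfrak M$, and $R_\varphi(a,c_1,\dots,c_n)$ holds iff there are representatives $b_j$ of $c_j$ with $\mathfrak M\models\varphi(a,b_1,\dots,b_n)$. $T^{\mathcal E}$ is the set of h-inductive $L_{\mathcal E}$-sentences true in $\mathfrak M^{\mathcal E}$, with monster model $\mathfrak M^{\mathcal E}$. *)

(* Defs.v *)
From mathcomp Require Import all_boot.
From mathcomp Require Import boolp classical_sets functions cardinality.

Set Implicit Arguments.
Unset Strict Implicit.
Unset Printing Implicit Defensive.

Local Open Scope classical_set_scope.
Local Open Scope card_scope.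

(* Signatures with sorts in S; a single-sorted signature is a signature over
   unit.  The places of a symbol are indexed by a finite type, so that places
   of different kinds can be told apart without casts. *)
Record signature (S : Type) := Signature {
  fsym : Type;
  farity : fsym -> finType;
  fdom : forall f, farity f -> S;
  fcod : fsym -> S;
  rsym : Type;
  rarity : rsym -> finType;
  rdom : forall r, rarity r -> S }.
Arguments farity {S} _ _.
Arguments fdom {S _} _ _.
Arguments fcod {S _} _.
Arguments rarity {S} _ _.
Arguments rdom {S _} _ _.

(* A tuple of variables, finite or infinite, is a type V of places together
   with the sort s : V -> S of each of them. *)
Definition sum_sort (S V W : Type) (s : V -> S) (t : W -> S) (u : V + W) : S :=
  match u with inl v => s v | inr w => t w end.

Definition ext_sort (S V : Type) (s : V -> S) (t : S) (u : option V) : S :=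
  match u with Some v => s v | None => t end.

Inductive term (S : Type) (L : signature S) (V : Type) (s : V -> S) :
    S -> Type :=
  | Var (v : V) : term L s (s v)
  | App (f : fsym L) (args : forall i : farity L f, term L s (fdom f i)) :
      term L s (fcod f).

(* Positive existential formulas whose free variables are among s *)
Inductive formula (S : Type) (L : signature S) (V : Type) (s : V -> S) : Type :=
  | Rel (r : rsym L) (args : forall i : rarity L r, term L s (rdom r i))
  | Eq (t : S) (t1 t2 : term L s t)
  | Top
  | Bot
  | And (phi psi : formula L s)
  | Or (phi psi : formula L s)
  | Ex (t : S) (phi : formula L (ext_sort s t)).

Record structure (S : Type) (L : signature S) := Structure {
  carrier :> S -> Type;
  carrier_inhabited : forall t, inhabited (carrier t);
  fint : forall f : fsym L,
    (forall i : farity L f, carrier (fdom f i)) -> carrier (fcod f);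
  rint : forall r : rsym L,
    (forall i : rarity L r, carrier (rdom r i)) -> Prop }.

Section Semantics.
Context {S : Type} {L : signature S} (M : structure L).

Definition env {V : Type} (s : V -> S) : Type := forall v, M (s v).

Definition sum_env {V W : Type} {s : V -> S} {t : W -> S}
    (a : env s) (b : env t) : env (sum_sort s t) :=
  fun u => match u with inl v => a v | inr w => b w end.

Definition ext_env {V : Type} {s : V -> S} {t : S} (a : env s) (x : M t) :
    env (ext_sort s t) :=
  fun u => match u with Some v => a v | None => x end.

Fixpoint eval {V : Type} {s : V -> S} (a : env s) {t : S} (u : term L s t) :
    M t :=
  match u with
  | Var v => a v
  | App f args => fint (fun i => eval a (args i))
  end.

Fixpoint sat {V : Type} {s : V -> S} (phi : formula L s) : env s -> Prop :=
  match phi with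
  | Rel r args => fun a => rint (fun i => eval a (args i))
  | Eq t t1 t2 => fun a => eval a t1 = eval a t2
  | Top => fun=> True
  | Bot => fun=> False
  | And phi psi => fun a => sat phi a /\ sat psi a
  | Or phi psi => fun a => sat phi a \/ sat psi a
  | Ex t phi => fun a => exists x : M t, sat phi (ext_env a x)
  end.

End Semantics.

(* The h-inductive sentence forall x, hyp x -> concl x *)
Record hsentence (S : Type) (L : signature S) := HSentence {
  hsize : nat;
  hsort : 'I_hsize -> S;
  hyp : formula L hsort;
  concl : formula L hsort }.

Definition holds (S : Type) (L : signature S) (M : structure L)
    (chi : hsentence L) : Prop :=
  forall a : env M (@hsort _ _ chi), sat (hyp chi) a -> sat (concl chi) a.

Definition theory (S : Type) (L : signature S) : Type := set (hsentence L).

Definition is_model (S : Type) (L : signature S) (T : theory L)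
    (M : structure L) : Prop :=
  forall chi, T chi -> holds M chi.

Section Morphisms.
Context {S : Type} {L : signature S}.

Record homomorphism (M N : structure L) (h : forall t, M t -> N t) : Prop := {
  hom_fint : forall (f : fsym L) (a : forall i, M (fdom f i)),
    h _ (fint a) = fint (fun i => h _ (a i));
  hom_rint : forall (r : rsym L) (a : forall i, M (rdom r i)),
    rint a -> rint (fun i => h _ (a i)) }.

Definition immersion (M N : structure L) (h : forall t, M t -> N t) : Prop :=
  homomorphism h /\
  forall (n : nat) (s : 'I_n -> S) (phi : formula L s) (a : env M s),
    sat phi (fun v => h _ (a v)) -> sat phi a.

Definition automorphism (M : structure L) (h : forall t, M t -> M t) : Prop :=
  exists g : forall t, M t -> M t,
    [/\ homomorphism h, homomorphism g,
        forall t, cancel (h t) (g t) & forall t, cancel (g t) (h t)].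

Definition JEP (T : theory L) : Prop :=
  forall M1 M2 : structure L, is_model T M1 -> is_model T M2 ->
  exists (N : structure L) (h1 : forall t, M1 t -> N t)
         (h2 : forall t, M2 t -> N t),
    [/\ is_model T N, homomorphism h1 & homomorphism h2].

Definition existentially_closed (T : theory L) (M : structure L) : Prop :=
  is_model T M /\
  forall (N : structure L) (h : forall t, M t -> N t),
    is_model T N -> homomorphism h -> immersion h.

End Morphisms.

(* The cardinal of A is smaller than the one of K *)
Definition small (K A : Type) : Prop :=
  ([set: A] #<= [set: K]) && ~~ ([set: K] #<= [set: A]).

(* Monster models, with respect to the cardinal |K| below which sets and
   tuples are called small *)
Record monster (K : Type) (S : Type) (L : signature S) (T : theory L)
    (M : structure L) : Prop := {
  monster_nat : small K nat;
  monster_sort : small K S;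
  monster_fsym : small K (fsym L);
  monster_rsym : small K (rsym L);
  monster_ec : existentially_closed T M;
  monster_saturated :
    forall (V A : Type) (s : V -> S) (t : A -> S) (a : env M t),
    small K V -> small K A ->
    forall Sigma : set (formula L (sum_sort s t)),
    (forall Delta, finite_set Delta -> Delta `<=` Sigma ->
       exists b : env M s, forall phi, Delta phi -> sat phi (sum_env b a)) ->
    exists b : env M s, forall phi, Sigma phi -> sat phi (sum_env b a);
  monster_homogeneous :
    forall (A : Type) (s : A -> S) (a b : env M s), small K A ->
    (forall phi : formula L s, sat phi a <-> sat phi b) ->
    exists h : forall t, M t -> M t,
      automorphism h /\ forall i, h _ (a i) = b i }.

(* phi(x, y) has SOP_1 in T, with parameters in the monster model M; the nodes
   of the tree 2^{<omega} are the boolean sequences, with 0 = false, 1 = true,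
   and a set of formulas is consistent when it is realised in M. *)
Definition has_SOP1 (S : Type) (L : signature S) (T : theory L)
    (M : structure L) (n m : nat) (sx : 'I_n -> S) (sy : 'I_m -> S)
    (phi : formula L (sum_sort sx sy)) : Prop :=
  exists (psi : formula L (sum_sort sy sy)) (a : seq bool -> env M sy),
  [/\ forall sigma : nat -> bool, exists b : env M sx,
        forall k, sat phi (sum_env b (a (mkseq sigma k))),
      forall N : structure L, is_model T N -> forall y1 y2 : env N sy,
        ~ (sat psi (sum_env y1 y2) /\
           exists x : env N sx,
             sat phi (sum_env x y1) /\ sat phi (sum_env x y2))
    & forall eta nu : seq bool, prefix (rcons eta false) nu ->
        sat psi (sum_env (a (rcons eta true)) (a nu))].

Definition NSOP1 (S : Type) (L : signature S) (T : theory L)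
    (M : structure L) : Prop :=
  forall (n m : nat) (sx : 'I_n -> S) (sy : 'I_m -> S)
    (phi : formula L (sum_sort sx sy)), ~ has_SOP1 T M phi.

Section Hyperimaginaries.
Context (L : signature unit).

(* The sort of a tuple of real variables *)
Definition real (I : Type) (i : I) : unit := tt.
Arguments real I i : clear implicits.

Context (M : structure L).

(* The set of partial types, as a family indexed by J: E j is a set of formulas
   E(x, y), where the places of x and of y are indexed by len j. *)
Context (J : Type) (len : J -> Type)
  (E : forall j, set (formula L (sum_sort (real (len j)) (real (len j))))).

Definition Erel (j : J) (b b' : env M (real (len j))) : Prop :=
  forall phi, E phi -> sat phi (sum_env b b').

(* The symbol R_phi of an L-formula phi(x, y_1, ..., y_n) *)
Record hyp_rsym := HypRsym {
  hr_real : nat;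
  hr_num : nat;
  hr_type : 'I_hr_num -> J;
  hr_formula : formula L (sum_sort (real 'I_hr_real)
                                   (real {k : 'I_hr_num & len (hr_type k)})) }.

(* The real sort is inl tt, the sort S_E of E = E j is inr j. *)
Definition hyp_signature : signature (unit + J) :=
  @Signature (unit + J)%type
    (fsym L) (farity L) (fun f i => inl (fdom f i)) (fun f => inl (fcod f))
    (rsym L + hyp_rsym)%type
    (fun r => match r with
       | inl r => rarity L r
       | inr R => ('I_(hr_real R) + 'I_(hr_num R))%type : finType
       end)
    (fun r => match r with
       | inl r => fun i => inl (rdom r i)
       | inr R => fun i => match i with
           | inl _ => inl tt
           | inr k => inr (hr_type k)
           end
       end).

Definition Eclass (j : J) : Type :=
  {c : set (env M (real (len j))) | exists b, c = [set b' | Erel b b']}.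

Definition hyp_carrier (t : unit + J) : Type :=
  match t with inl u => M u | inr j => Eclass j end.

Fact hyp_carrier_inhabited t : inhabited (hyp_carrier t).
Proof.
case: t => [u|j] /=; first exact: carrier_inhabited.
have [x] := carrier_inhabited M tt.
by constructor; exists [set b' | Erel (fun=> x) b']; exists (fun=> x).
Qed.

Definition hyp_rint (R : hyp_rsym) (a : env M (real 'I_(hr_real R)))
    (c : forall k : 'I_(hr_num R), Eclass (hr_type k)) : Prop :=
  exists b : forall k : 'I_(hr_num R), env M (real (len (hr_type k))),
    (forall k, sval (c k) (b k)) /\
    sat (hr_formula R) (sum_env a (fun p => b (tag p) (tagged p))).

Definition hyp_structure : structure hyp_signature :=
  @Structure _ hyp_signature hyp_carrier hyp_carrier_inhabited
    (fun f a => @fint _ _ M f a)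
    (fun r => match r return
         (forall i : rarity hyp_signature r, hyp_carrier (@rdom _ hyp_signature r i)) -> Prop
       with
       | inl r => fun a => @rint _ _ M r a
       | inr R => fun a => hyp_rint (fun i => a (inl i)) (fun k => a (inr k))
       end).

Definition hyp_theory : theory hyp_signature :=
  [set chi | holds hyp_structure chi].

End Hyperimaginaries.
Arguments real I i : clear implicits.
Arguments Erel {L} M {J len} E j b b'.
Arguments hyp_structure {L} M {J len} E.
Arguments hyp_theory {L} M {J len} E _.

(* Main.v *)
Require Import Defs.
From Corelib Require RelationClasses.
From mathcomp Require Import all_boot.
From mathcomp Require Import boolp classical_sets functions cardinality.

(* In both monster models, satisfiability of a positive formula is the same as
   consistency with the theory: by JEP and existential closedness for T, by
   definition for its hyperimaginary extension.  So SOP1 is a statement about a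
   tree in the monster model, and a tree for T is also one for the extension.

   For the converse, replace every hyperimaginary by a representative, an
   infinite real tuple.  By saturation, a formula of the extension becomes a
   partial type in the representatives: existential quantification over a
   hyperimaginary, or over the representatives in R_phi, is quantification over
   an infinite tuple, which commutes with directed intersections of definable
   sets.  The partial types of psi(y1, y2), phi(x, y1) and phi(x, y2) are
   jointly inconsistent, so by compactness L-formulas implied by them already
   are, and these mention only finitely many coordinates of the tuples. *)

Set Implicit Arguments.
Unset Strict Implicit.
Unset Printing Implicit Defensive.

Local Open Scope classical_set_scope.
Local Open Scope card_scope.

(** * Cardinals *)

Lemma card_leT_injP A B :
  reflect (exists f : A -> B, injective f) ([set: A] #<= [set: B]).
Proof.
apply: (iffP card_leP) => [/injfunPex[f _ fI]|[f fI]].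
  exists (fun x => \val (f (SigSub (mem_set (I : [set: A] x))))) => x y.
  by move=> /val_inj/fI; rewrite !in_setT => /(_ isT isT)/(congr1 val).
apply/card_leP; apply: card_le_trans (card_leT (range f)).
by have /card_eqPle[] := inj_card_eq (in2W fI : {in [set: A] &, injective f}).
Qed.

Lemma infinite_set_inj T (A : set T) : infinite_set A ->
  exists2 f : nat -> T, injective f & forall n, A (f n).
Proof.
move=> /infiniteP/card_leP/injfunPex[f _ fI].
exists (fun n => \val (f (SigSub (mem_set (I : [set: nat] n))))) => [m n|n].
  by move=> /val_inj/fI; rewrite !in_setT => /(_ isT isT)/(congr1 val).
exact: set_valP.
Qed.

Lemma exists_max_clique T (r : T -> T -> Prop) : exists C : set T,
  (forall x y, C x -> C y -> r x y) /\
  forall z, r z z -> (forall x, C x -> r x z /\ r z x) -> C z.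
Proof.
have [|C [Cr Cmax]] := @Zorn_bigcup _ [set C | forall x y, C x -> C y -> r x y].
  move=> F Fr Ftot x y [X FX Xx] [Y FY Yy].
  by have [XY|YX] := Ftot X Y FX FY;
    [apply: (Fr Y) => //; apply: XY | apply: (Fr X) => //; apply: YX].
exists C; split=> // z rzz Crz; apply: contrapT => Cz.
case: (Cmax (C `|` [set z])).
  by split=> [x|/(_ z (or_intror erefl))//]; left.
move=> x y [Cx|->] [Cy|->] //; first exact: Cr.
  by have [] := Crz x Cx.
by have [] := Crz y Cy.
Qed.

Lemma card_leT_total A B : ([set: A] #<= [set: B]) || ([set: B] #<= [set: A]).
Proof.
have [R [Rinj Rmax]] :=
  @exists_max_clique (A * B) (fun p q => p.1 = q.1 <-> p.2 = q.2).
apply/orP.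
have [/choice[f Rf]|/existsNP[a Ra]] := pselect (forall a, exists b, R (a, b)).
  by left; apply/card_leT_injP; exists f => x y /(Rinj _ _ (Rf x) (Rf y)).2.
have [/choice[g Rg]|/existsNP[b Rb]] := pselect (forall b, exists a, R (a, b)).
  by right; apply/card_leT_injP; exists g => x y /(Rinj _ _ (Rg x) (Rg y)).1.
have Rab : R (a, b); last by case: Ra; exists b.
apply: Rmax => // -[a' b'] R'.
have a'a : a' <> a by move=> e; apply: Ra; exists b'; rewrite -e.
have b'b : b' <> b by move=> e; apply: Rb; exists a'; rewrite -e.
by split; split=> /= e; [case: a'a|case: b'b|case: a'a|case: b'b].
Qed.

(* A maximal family F of disjoint sequences in B misses only a finite set; the
   even terms of the copies of nat in F * nat are used to list that set. *)
Lemma infinite_card_setX_nat B : infinite_set [set: B] ->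
  exists F : Type, [set: F * nat] #= [set: B].
Proof.
move=> infB.
have [F [Finj Fmax]] := @exists_max_clique (nat -> B)
  (fun f g => forall m n, f m = g n -> f = g /\ m = n).
pose D := [set x | forall f, F f -> forall n, f n <> x].
have noseqD (h : nat -> B) : injective h -> ~ (forall n, D (h n)).
  move=> hI Dh; suff Fh : F h by apply: (Dh 0%N h Fh 0%N).
  apply: Fmax => [m n /hI //|f Ff].
  by split=> m n e; [case: (Dh n f Ff m)|case: (Dh m f Ff n)].
have finD : finite_set D.
  by apply: contrapT => /infinite_set_inj[h /noseqD].
have [l Dl] := (@finite_seqP {classic B} D).1 finD.
have [f0 Ff0] : exists f, F f.
  apply: contrapT => nF; apply: infB.
  suff -> : [set: B] = D by [].
  by apply/seteqP; split=> x // _ f Ff; case: nF; exists f.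
exists {f | F f}; apply/card_eqPle; split.
  apply/card_leT_injP; exists (fun p => sval p.1 p.2) => -[[f Ff] m] [[g Fg] n].
  by move=> /= /(Finj _ _ Ff Fg)[e ->]; congr (_, _); apply: eq_exist.
pose h (p : {f | F f} * nat) :=
  if odd p.2 then sval p.1 p.2./2 else nth (f0 0) (l : seq B) p.2./2.
suff <- : range h = [set: B] by apply: card_image_le.
apply/seteqP; split=> x // _; have [Dx|] := pselect (D x).
  exists (exist _ f0 Ff0, (index (x : {classic B}) l).*2) => //.
  rewrite /h /= odd_double doubleK.
  by apply: (@nth_index {classic B}); move: Dx; rewrite Dl.
move=> /existsNP[f /not_implyP[Ff /existsNP[n /contrapT <-]]].
by exists (exist _ f Ff, n.*2.+1); rewrite // /h /= odd_double /= uphalf_double.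
Qed.

Lemma infinite_card_setX_bool B :
  infinite_set [set: B] -> [set: B * bool] #<= [set: B].
Proof.
move=> /infinite_card_setX_nat[F /card_eqPle[/card_leT_injP[j jI]]].
move=> /card_leT_injP[i iI]; apply/card_leT_injP.
exists (fun p : B * bool => j ((i p.1).1, (p.2 + (i p.1).2.*2)%N)).
move=> [x b] [y c] /= /jI[ixy1 e].
have bc : b = c by have := congr1 odd e; rewrite !oddD !odd_double !addbF !oddb.
have := congr1 half e; rewrite bc !half_bit_double => ixy2.
congr (_, _) => //; apply: iI.
by rewrite [LHS]surjective_pairing ixy1 ixy2 -surjective_pairing.
Qed.

Section Small.
Context {K : Type} (natK : small K nat).

Lemma small_le A B : [set: A] #<= [set: B] -> small K B -> small K A.
Proof.
move=> AB /andP[BK KB]; apply/andP; split; first exact: card_le_trans BK.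
by apply: contra KB => KA; apply: card_le_trans AB.
Qed.

Lemma small_surj A B (f : A -> B) :
  (forall b, exists a, f a = b) -> small K A -> small K B.
Proof.
move=> fS; apply: small_le; have <- : range f = [set: B].
  by apply/seteqP; split=> b // _; have [a <-] := fS b; exists a.
exact: card_image_le.
Qed.

Lemma small_countable A : countable [set: A] -> small K A.
Proof. by move=> cA; apply: small_le natK. Qed.

Lemma small_countType (A : countType) : small K A.
Proof. exact/small_countable/countableP. Qed.

Lemma small_setX_bool B : small K B -> small K (B * bool).
Proof.
move=> sB; have [finB|infB] := pselect (finite_set [set: B]).
  apply/small_countable/finite_set_countable.
  by rewrite -setXTT; apply: finite_setX.
exact: small_le (infinite_card_setX_bool infB) sB.
Qed.

Lemma small_sum A B : small K A -> small K B -> small K (A + B).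
Proof.
wlog /card_leT_injP[f fI] : A B / [set: A] #<= [set: B].
  move=> small_sum_le sA sB; have /orP[AB|BA] := card_leT_total A B.
    exact: small_sum_le.
  pose swap (u : B + A) : A + B :=
    match u with inl b => inr b | inr a => inl a end.
  apply: (small_surj (f := swap)) (small_sum_le B A BA sB sA).
  by move=> [a|b]; [exists (inr a)|exists (inl b)].
move=> _ /small_setX_bool; apply: small_le; apply/card_leT_injP.
exists (fun u => match u with inl a => (f a, true) | inr b => (b, false) end).
by move=> [a|b] [a'|b'] // [] => [/fI|] ->.
Qed.

Lemma small_tag_ord n (P : 'I_n -> Type) :
  (forall i, small K (P i)) -> small K {i : 'I_n & P i}.
Proof.
elim: n P => [|n IH] P sP.
  by apply/small_le/natK/card_leT_injP; exists (fun x => tag x) => -[[]].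
pose f (u : P ord0 + {i : 'I_n & P (lift ord0 i)}) : {i : 'I_n.+1 & P i} :=
  match u with
  | inl p => existT _ ord0 p
  | inr q => existT P (lift ord0 (tag q)) (tagged q)
  end.
apply: (small_surj (f := f)); last exact/small_sum/IH.
move=> [i p]; case: (unliftP ord0 i) p => [j ->|->] p.
  by exists (inr (existT _ j p)).
by exists (inl p).
Qed.

End Small.

(** * Substitution *)

Section Substitution.
Context {S : Type} {L : signature S}.

Fixpoint term_vars {V : Type} {s : V -> S} {t : S} (u : term L s t) : set V :=
  match u with
  | Var v => [set v]
  | App f args => \bigcup_i term_vars (args i)
  end.

Fixpoint vars {V : Type} {s : V -> S} (phi : formula L s) : set V :=
  match phi with
  | Rel r args => \bigcup_i term_vars (args i)
  | Eq t t1 t2 => term_vars t1 `|` term_vars t2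
  | Top => set0
  | Bot => set0
  | And phi psi => vars phi `|` vars psi
  | Or phi psi => vars phi `|` vars psi
  | Ex t phi => Some @^-1` vars phi
  end.

Lemma finite_term_vars V (s : V -> S) t (u : term L s t) :
  finite_set (term_vars u).
Proof.
by elim: u => [v|f args IH] /=; [exact: finite_set1|exact: bigcup_finite].
Qed.

Lemma finite_vars V (s : V -> S) (phi : formula L s) : finite_set (vars phi).
Proof.
elim: phi => {V s} [V s r args|V s t t1 t2|V s|V s|V s p IHp q IHq
  |V s p IHp q IHq|V s t p IHp] /=; rewrite ?finite_setU //.
- by apply: bigcup_finite => // i _; apply: finite_term_vars.
- by split; apply: finite_term_vars.
- by apply: finite_preimage IHp => x y _ _ [].
Qed.

(* Terms need only be substituted for the variables that occur: this is what
   allows a formula in an infinite tuple to be rewritten as a formula in a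
   finite subtuple, even when there is no closed term. *)
Fixpoint term_subst {V V' : Type} {s : V -> S} {s' : V' -> S} {t : S}
    (u : term L s t) :
    (forall v, term_vars u v -> term L s' (s v)) -> term L s' t :=
  match u with
  | Var v => fun f => f v erefl
  | App g args => fun f =>
      App (fun i =>
        term_subst (u := args i) (fun v uv => f v (ex_intro2 _ _ i I uv)))
  end.

Definition lift_subst {V V' : Type} {s : V -> S} {s' : V' -> S} {t : S}
    {D : set (option V)} (f : forall v, D (Some v) -> term L s' (s v)) u :
    D u -> term L (ext_sort s' t) (ext_sort s t u) :=
  match u with
  | Some v => fun Dv =>
      term_subst (u := f v Dv) (fun v' _ => Var L (ext_sort s' t) (Some v'))
  | None => fun=> Var L (ext_sort s' t) None
  end.

Fixpoint subst {V V' : Type} {s : V -> S} {s' : V' -> S} (phi : formula L s) :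
    (forall v, vars phi v -> term L s' (s v)) -> formula L s' :=
  match phi with
  | Rel r args => fun f =>
      Rel (fun i =>
        term_subst (u := args i) (fun v uv => f v (ex_intro2 _ _ i I uv)))
  | Eq t t1 t2 => fun f =>
      Eq (term_subst (u := t1) (fun v uv => f v (or_introl uv)))
         (term_subst (u := t2) (fun v uv => f v (or_intror uv)))
  | Top => fun=> Top _ _
  | Bot => fun=> Bot _ _
  | And phi psi => fun f =>
      And (subst (phi := phi) (fun v pv => f v (or_introl pv)))
          (subst (phi := psi) (fun v pv => f v (or_intror pv)))
  | Or phi psi => fun f =>
      Or (subst (phi := phi) (fun v pv => f v (or_introl pv)))
         (subst (phi := psi) (fun v pv => f v (or_intror pv)))
  | Ex t phi => fun f => Ex (subst (phi := phi) (lift_subst f))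
  end.

Arguments term_subst {V V' s s' t} u f.
Arguments subst {V V' s s'} phi f.

Section Semantics.
Context {M : structure L}.

Lemma eq_fint f (x y : forall i : farity L f, M (fdom f i)) :
  (forall i, x i = y i) -> fint x = fint y.
Proof. by move=> xy; congr fint; apply: functional_extensionality_dep. Qed.

Lemma eq_rint r (x y : forall i : rarity L r, M (rdom r i)) :
  (forall i, x i = y i) -> rint x <-> rint y.
Proof.
by move=> xy; have -> : x = y by apply: functional_extensionality_dep.
Qed.

Lemma eval_subst V V' (s : V -> S) (s' : V' -> S) t (u : term L s t)
    (f : forall v, term_vars u v -> term L s' (s v)) (a : env M s')
    (b : env M s) :
  (forall v uv, eval a (f v uv) = b v) -> eval a (term_subst u f) = eval b u.
Proof.
elim: u f => [v|g args IH] f fb /=; first exact: fb.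
by apply: eq_fint => i; apply: IH => v uv; apply: fb.
Qed.

Lemma sat_subst V V' (s : V -> S) (s' : V' -> S) (phi : formula L s)
    (f : forall v, vars phi v -> term L s' (s v)) (a : env M s') (b : env M s) :
  (forall v pv, eval a (f v pv) = b v) -> sat (subst phi f) a <-> sat phi b.
Proof.
elim: phi V' s' f a b => {V s} [V s r args|V s t t1 t2|V s|V s|V s p IHp q IHq
  |V s p IHp q IHq|V s t p IHp] V' s' f a b fb //=.
- by apply: eq_rint => i; apply: eval_subst => v uv; apply: fb.
- by rewrite !(eval_subst (b := b)) // => v uv; apply: fb.
- by rewrite (IHp _ _ _ a b) ?(IHq _ _ _ a b) // => v uv; apply: fb.
- by rewrite (IHp _ _ _ a b) ?(IHq _ _ _ a b) // => v uv; apply: fb.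
- have IHx x :
      sat (subst p (lift_subst f)) (ext_env a x) <-> sat p (ext_env b x).
    by apply: IHp => -[v|] //= pv; rewrite -(fb v pv); apply: eval_subst.
  by split=> -[x /IHx]; exists x.
Qed.

Lemma eq_sat V (s : V -> S) (phi : formula L s) (a b : env M s) :
  (forall v, a v = b v) -> sat phi a <-> sat phi b.
Proof.
by move=> ab; have -> : a = b by apply: functional_extensionality_dep.
Qed.

Lemma sum_env_eta V W (s : V -> S) (t : W -> S) (e : env M (sum_sort s t)) :
  sum_env (fun v => e (inl v)) (fun w => e (inr w)) = e.
Proof. by apply: functional_extensionality_dep => -[]. Qed.

Lemma env_inhabited V (s : V -> S) : inhabited (env M s).
Proof.
constructor=> v; have /cid[x _] : exists x : M (s v), True; last exact: x.
by have [x] := carrier_inhabited M (s v); exists x.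
Qed.

Lemma env_extend V V' (s : V -> S) (f : V' -> V)
    (a : env M (fun v' => s (f v'))) :
  injective f -> exists b : env M s, (fun v' => b (f v')) = a.
Proof.
move=> fI.
have b v : {x : M (s v) |
    forall v' (e : f v' = v), ecast v (M (s v)) e (a v') = x}.
  have [/cid[v' e]|nf] := pselect (exists v', f v' = v).
    case: v / e; exists (a v') => v'' e.
    by have e' := fI _ _ e; subst v''; rewrite (Prop_irrelevance e erefl).
  apply: cid; have [x] := carrier_inhabited M (s v).
  by exists x => v' e; case: nf; exists v'.
exists (fun v => sval (b v)); apply: functional_extensionality_dep => v'.
by rewrite -(svalP (b (f v')) v' erefl).
Qed.

End Semantics.

Lemma sat_hom (M N : structure L) (h : forall t, M t -> N t) :
  homomorphism h -> forall V (s : V -> S) (phi : formula L s) (a : env M s),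
  sat phi a -> sat phi (fun v => h _ (a v)).
Proof.
move=> [hf hr].
have eval_h V (s : V -> S) t (u : term L s t) (a : env M s) :
    eval (fun v => h _ (a v)) u = h _ (eval a u).
  by elim: u => //= f args IH; rewrite hf; apply: eq_fint.
move=> V s; elim=> {V s} [V s r args|V s t t1 t2|V s|V s|V s p IHp q IHq
  |V s p IHp q IHq|V s t p IHp] a //=.
- by move=> /hr; apply: (eq_rint _).1 => i; rewrite eval_h.
- by rewrite !eval_h => ->.
- by move=> [/IHp ? /IHq].
- by move=> [/IHp ?|/IHq]; [left|right].
- by move=> [x /IHp px]; exists (h _ x); move: px; apply: (eq_sat _ _).1 => -[].
Qed.

(** * Finite supports and quantification over infinite tuples *)

Lemma finite_set_range V (D : set V) : finite_set D ->
  exists (n : nat) (f : 'I_n -> V), injective f /\ D `<=` range f.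
Proof.
move=> /(@finite_seqP {classic V})[l ->].
exists (size (undup l)), (tnth (in_tuple (undup l))); split.
  by apply/(tuple_uniqP (in_tuple _)); apply: undup_uniq.
move=> v /=; rewrite -mem_undup => vl.
by have /tnthP[i ->] : (v : {classic V}) \in in_tuple (undup l) by []; exists i.
Qed.

Lemma restrict_sum_vars V V' W W' (s : V -> S) (t : W -> S)
    (f : V' -> V) (g : W' -> W) (phi : formula L (sum_sort s t)) :
  inl @^-1` vars phi `<=` range f -> inr @^-1` vars phi `<=` range g ->
  exists phi' : formula L (sum_sort (fun v' => s (f v')) (fun w' => t (g w'))),
    forall (M : structure L) (a : env M s) (b : env M t),
    sat phi' (sum_env (fun v' => a (f v')) (fun w' => b (g w'))) <->
    sat phi (sum_env a b).
Proof.
move=> fphi gphi; pose s' := sum_sort (fun v' => s (f v')) (fun w' => t (g w')).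
have var_of u (pu : vars phi u) : {x : term L s' (sum_sort s t u) |
    forall (M : structure L) (a : env M s) (b : env M t),
    eval (sum_env (fun v' => a (f v')) (fun w' => b (g w'))) x = sum_env a b u}.
  case: u pu => [v /fphi/cid2[v' _ <-]|w /gphi/cid2[w' _ <-]].
    by exists (Var L s' (inl v')).
  by exists (Var L s' (inr w')).
exists (subst phi (fun u pu => sval (var_of u pu))) => M a b.
by apply: sat_subst => u pu; apply: (svalP (var_of u pu)).
Qed.

Lemma env_cons (M : structure L) n (s : 'I_n.+1 -> S) (x : M (s ord0))
    (c : env M (fun i => s (lift ord0 i))) :
  exists d : env M s, d ord0 = x /\ forall i, d (lift ord0 i) = c i.
Proof.
pose f (u : option 'I_n) : 'I_n.+1 := oapp (lift ord0) ord0 u.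
have fI : injective f.
  by move=> [i|] [j|] //= /lift_inj ->.
have [d dE] := @env_extend M _ _ s f
  (fun u => match u with Some i => c i | None => x end) fI.
by exists d; split=> [|i]; [exact: (congr1 (fun e => e None) dE)
  |exact: (congr1 (fun e => e (Some i)) dE)].
Qed.

Lemma ex_finite_tuple n W (s : 'I_n -> S) (t : W -> S)
    (phi : formula L (sum_sort s t)) :
  exists phi' : formula L t, forall (M : structure L) (b : env M t),
  sat phi' b <-> exists c : env M s, sat phi (sum_env c b).
Proof.
elim: n W s t phi => [|n IH] W s t phi.
  pose f u : term L t (sum_sort s t u) :=
    match u with
    | inl i => False_rect _ (notF (ltn_ord i))
    | inr w => Var L t w
    end.
  have sat_f M (c : env M s) b : sat (subst phi (fun u _ => f u)) b <->
      sat phi (sum_env c b) by apply: sat_subst => -[[]|].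
  exists (subst phi (fun u _ => f u)) => M b; have [c] := @env_inhabited M _ s.
  by split=> [/(sat_f M c)|[c' /sat_f //]]; exists c.
pose s' i := s (lift ord0 i); pose t' := ext_sort t (s ord0).
have var_of u : {x : term L (sum_sort s' t') (sum_sort s t u) |
    forall (M : structure L) (c : env M s) (b : env M t),
    eval (sum_env (fun i => c (lift ord0 i)) (ext_env b (c ord0))) x =
    sum_env c b u}.
  case: u => [i|w]; last by exists (Var L (sum_sort s' t') (inr (Some w))).
  case: (unliftP ord0 i) => [j ->|->].
    by exists (Var L (sum_sort s' t') (inl j)).
  by exists (Var L (sum_sort s' t') (inr None)).
have [phi' phi'P] := IH _ s' t' (subst phi (fun u _ => sval (var_of u))).
have sat_phi M (c : env M s) b :
    sat (subst phi (fun u _ => sval (var_of u)))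
      (sum_env (fun i => c (lift ord0 i)) (ext_env b (c ord0))) <->
    sat phi (sum_env c b) by apply: sat_subst => u _; apply: (svalP (var_of u)).
exists (Ex phi') => M b.
split=> [[x /phi'P[c' c'x]]|[c /sat_phi phic]]; last first.
  by exists (c ord0); apply/phi'P; exists (fun i => c (lift ord0 i)).
have [c [c_ord0 c_lift]] := env_cons x c'.
exists c; apply/sat_phi; rewrite c_ord0.
by move: c'x; apply: (eq_sat _ _).1 => -[i|u] //=; rewrite c_lift.
Qed.

Lemma ex_tuple V W (s : V -> S) (t : W -> S) (phi : formula L (sum_sort s t)) :
  exists phi' : formula L t, forall (M : structure L) (b : env M t),
  sat phi' b <-> exists c : env M s, sat phi (sum_env c b).
Proof.
have [n [f [fI fphi]]] :=
  finite_set_range (finite_preimage (in2W inl_inj) (finite_vars phi)).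
have [|phi1 phi1P] := restrict_sum_vars (g := id) fphi.
  by move=> w _; exists w.
have [phi2 phi2P] := ex_finite_tuple phi1; exists phi2 => M b; rewrite phi2P.
split=> [[c phic]|[c /phi1P]]; last by exists (fun i => c (f i)).
by have [c' cE] := env_extend c fI; exists c'; apply/phi1P; rewrite cE.
Qed.

Definition no_sort (i : 'I_0) : S := False_rect S (notF (ltn_ord i)).

Lemma ex_closure V (s : V -> S) (phi : formula L s) :
  exists phi' : formula L no_sort, forall (M : structure L) (e : env M no_sort),
  sat phi' e <-> exists a : env M s, sat phi a.
Proof.
have [phi' phi'P] :=
  ex_tuple (subst phi (fun v _ => Var L (sum_sort s no_sort) (inl v))).
exists phi' => M e; rewrite phi'P.
by split=> -[a phia]; exists a; move: phia; rewrite (sat_subst (b := a)).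
Qed.

End Substitution.
Arguments term_subst {S L V V' s s' t} u f.
Arguments subst {S L V V' s s'} phi f.

(** * Type-definable sets *)

Section TypeDefinable.
Context {S : Type} {L : signature S} {M : structure L}.

Definition directed {V : Type} {s : V -> S} (Sigma : set (formula L s)) :
    Prop :=
  Sigma !=set0 /\ forall phi psi, Sigma phi -> Sigma psi ->
    exists2 chi, Sigma chi &
      forall a : env M s, sat chi a -> sat phi a /\ sat psi a.

Lemma directed_finite V (s : V -> S) (Sigma Delta : set (formula L s)) :
  directed Sigma -> finite_set Delta -> Delta `<=` Sigma ->
  exists2 chi, Sigma chi &
    forall phi (a : env M s), Delta phi -> sat chi a -> sat phi a.
Proof.
move=> [[chi0 S0] Sand] /(@finite_seqP {classic formula L s})[l ->].
elim: l => [|phi l IH] lS; first by exists chi0.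
have [|chi Schi chiP] := IH.
  by move=> psi /= psil; apply: lS; rewrite /= inE psil orbT.
have [|chi' Schi' chi'P] := Sand phi chi _ Schi.
  by apply: lS; rewrite /= inE eqxx.
exists chi' => // psi a; rewrite /= inE => /predU1P[->|psil] /chi'P[] //.
by move=> _; apply: chiP.
Qed.

Definition type_definable {V : Type} {s : V -> S} (P : set (env M s)) : Prop :=
  exists Sigma : set (formula L s),
  forall a, P a <-> forall phi, Sigma phi -> sat phi a.

Lemma type_definableP V (s : V -> S) (P : set (env M s)) :
  type_definable P <->
  forall a, (forall phi : formula L s, P `<=` sat phi -> sat phi a) -> P a.
Proof.
split=> [[Sigma PSigma] a Pa|cP].
  by apply/PSigma => phi Sphi; apply: Pa => b /PSigma; apply.
by exists [set phi | P `<=` sat phi] => a; split=> [Pa phi|/cP //]; apply.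
Qed.

Lemma eq_type_definable V (s : V -> S) (P Q : set (env M s)) :
  (forall a, P a <-> Q a) -> type_definable P -> type_definable Q.
Proof. by move=> /predeqP ->. Qed.

Lemma type_definable_sat V (s : V -> S) (phi : formula L s) :
  type_definable (sat (M := M) phi).
Proof. by exists [set phi] => a; split=> [pa _ ->|]; last exact. Qed.

Lemma type_definable_forall V (s : V -> S) I (P : I -> set (env M s)) :
  (forall i, type_definable (P i)) -> type_definable [set a | forall i, P i a].
Proof.
move=> cP; apply/type_definableP => a Pa i.
by apply: (type_definableP _).1 => // phi Pphi; apply: Pa => b /(_ i)/Pphi.
Qed.

Lemma type_definableI V (s : V -> S) (P Q : set (env M s)) :
  type_definable P -> type_definable Q -> type_definable (P `&` Q).
Proof.
move=> /type_definableP cP /type_definableP cQ; apply/type_definableP => a PQa.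
by split; [apply: cP|apply: cQ] => phi H; apply: PQa => b [Pb Qb]; apply: H.
Qed.

Lemma type_definableU V (s : V -> S) (P Q : set (env M s)) :
  type_definable P -> type_definable Q -> type_definable (P `|` Q).
Proof.
move=> /type_definableP cP /type_definableP cQ; apply/type_definableP => a PQa.
apply: contrapT => /not_orP[nP nQ].
apply: nP; apply: cP => phi Pphi; apply: contrapT => nphi.
apply: nQ; apply: cQ => psi Qpsi; apply: contrapT => npsi.
suff: sat (Or phi psi) a by case.
by apply: PQa => b [/Pphi|/Qpsi]; [left|right].
Qed.

Definition term_map {V W : Type} {s : V -> S} {t : W -> S}
    (g : env M t -> env M s) : Prop :=
  forall v, exists u : term L t (s v), forall a, eval a u = g a v.

Lemma type_definable_preimage V W (s : V -> S) (t : W -> S)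
    (g : env M t -> env M s) (P : set (env M s)) :
  term_map g -> type_definable P -> type_definable (g @^-1` P).
Proof.
move=> gT /type_definableP cP; apply/type_definableP => a Pa.
apply: cP => phi Pphi.
pose f v := sval (cid (gT v)).
have sat_f b : sat (subst phi (fun v _ => f v)) b <-> sat phi (g b).
  by apply: sat_subst => v _; apply: (svalP (cid (gT v))).
by apply/sat_f/Pa => b Pb; apply/sat_f/Pphi.
Qed.

Section Monster.
Context {K : Type} {T : theory L} (mM : monster K T M).

Lemma saturated_directed V A (s : V -> S) (t : A -> S) (a : env M t)
    (Sigma : set (formula L (sum_sort s t))) :
  small K V -> small K A -> directed Sigma ->
  (forall phi, Sigma phi -> exists b : env M s, sat phi (sum_env b a)) ->
  exists b : env M s, forall phi, Sigma phi -> sat phi (sum_env b a).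
Proof.
move=> sV sA dS Ssat; apply: (monster_saturated mM) => // Delta finD DS.
have [chi /Ssat[b chib] chiP] := directed_finite dS finD DS.
by exists b => phi /chiP; apply.
Qed.

Lemma compact_directed V (s : V -> S) (Sigma : set (formula L s)) :
  small K V -> directed Sigma ->
  (forall phi, Sigma phi -> exists b : env M s, sat phi b) ->
  exists b : env M s, forall phi, Sigma phi -> sat phi b.
Proof.
move=> sV [[phi0 S0] Sand] Ssat.
pose emb (phi : formula L s) :=
  subst phi (fun v _ => Var L (sum_sort s no_sort) (inl v)).
have sat_emb phi b : sat (emb phi) b <-> sat phi (fun v => b (inl v) : M (s v)).
  exact: sat_subst.
have [e] := @env_inhabited _ _ M _ no_sort.
have sI0 : small K 'I_0 := small_countType (monster_nat mM) _.
have [||b bP] := @saturated_directed _ _ s no_sort e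
    [set emb phi | phi in Sigma] sV sI0.
- split=> [|_ _ [phi Sphi <-] [psi Spsi <-]]; first by exists (emb phi0), phi0.
  have [chi Schi chiP] := Sand phi psi Sphi Spsi.
  exists (emb chi) => [|a /sat_emb/chiP[? ?]]; first by exists chi.
  by split; apply/sat_emb.
- by move=> _ [phi /Ssat[b phib] <-]; exists b; apply/sat_emb.
by exists b => phi Sphi; apply/(sat_emb phi (sum_env b e))/bP; exists phi.
Qed.

Lemma type_definable_ex V W (s : V -> S) (t : W -> S)
    (P : set (env M (sum_sort s t))) :
  small K V -> small K W -> type_definable P ->
  type_definable [set b | exists c, P (sum_env c b)].
Proof.
move=> sV sW /type_definableP cP; apply/type_definableP => b Pb.
have [||c Pc] := @saturated_directed _ _ s t b [set phi | P `<=` sat phi] sV sW.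
- split=> [|phi psi Pphi Ppsi]; first by exists (Top _ _).
  by exists (And phi psi) => // a Pa; split; [apply: Pphi|apply: Ppsi].
- move=> phi Pphi; have [psi psiP] := ex_tuple phi.
  by apply/psiP/Pb => b' [c Pc]; apply/psiP; exists c; apply: Pphi.
by exists c; apply: cP.
Qed.

End Monster.
End TypeDefinable.
Arguments directed {S L} M {V s} Sigma.

(** * SOP1 trees *)

Section SOP1.
Context {S : Type} {L : signature S}.

(* SOP1 read in M alone, for possibly infinite tuples x and y and for arbitrary
   sets P(x, y) and Q(y1, y2) in place of the formulas phi and psi. *)
Definition SOP1_tree {M : structure L} {X Y : Type} {sx : X -> S} {sy : Y -> S}
    (P : set (env M (sum_sort sx sy))) (Q : set (env M (sum_sort sy sy)))
    (a : seq bool -> env M sy) : Prop :=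
  [/\ forall sigma : nat -> bool, exists b, forall k,
        P (sum_env b (a (mkseq sigma k))),
      forall x y1 y2,
        ~ [/\ Q (sum_env y1 y2), P (sum_env x y1) & P (sum_env x y2)]
    & forall eta nu : seq bool, prefix (rcons eta false) nu ->
        Q (sum_env (a (rcons eta true)) (a nu))].

Section Clash.
Context {X Y : Type} {sx : X -> S} {sy : Y -> S}.

Let sxyy := sum_sort sx (sum_sort sy sy).

Definition clash (phi : formula L (sum_sort sx sy))
    (psi : formula L (sum_sort sy sy)) : formula L sxyy :=
  And (subst psi (fun u _ => Var L sxyy (inr u)))
    (And (subst phi (fun u _ => match u with
            | inl x => Var L sxyy (inl x)
            | inr y => Var L sxyy (inr (inl y))
            end))
         (subst phi (fun u _ => match u with
            | inl x => Var L sxyy (inl x)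
            | inr y => Var L sxyy (inr (inr y))
            end))).

Lemma sat_clash (M : structure L) phi psi (x : env M sx) (y1 y2 : env M sy) :
  sat (clash phi psi) (sum_env x (sum_env y1 y2)) <->
  [/\ sat psi (sum_env y1 y2), sat phi (sum_env x y1) & sat phi (sum_env x y2)].
Proof.
rewrite /= (sat_subst (b := sum_env y1 y2)) // (sat_subst (b := sum_env x y1));
  last by case.
rewrite (sat_subst (b := sum_env x y2)); last by case.
by split=> [[? []]|[]].
Qed.

Lemma clash_env (M : structure L) (a : env M sxyy) :
  exists x y1 y2, a = sum_env x (sum_env y1 y2).
Proof.
exists (fun v => a (inl v)), (fun v => a (inr (inl v))),
  (fun v => a (inr (inr v))).
by rewrite (sum_env_eta (fun u => a (inr u))) sum_env_eta.
Qed.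

Lemma unsat_clash K (T : theory L) (M : structure L)
    (P : set (env M (sum_sort sx sy))) (Q : set (env M (sum_sort sy sy))) :
  monster K T M -> small K X -> small K Y ->
  type_definable P -> type_definable Q ->
  (forall x y1 y2,
     ~ [/\ Q (sum_env y1 y2), P (sum_env x y1) & P (sum_env x y2)]) ->
  exists phi psi, [/\ P `<=` sat phi, Q `<=` sat psi &
    forall e : env M sxyy, ~ sat (clash phi psi) e].
Proof.
move=> mM sX sY /type_definableP cP /type_definableP cQ PQ.
apply: contrapT => all_sat.
pose Sigma := [set clash phi psi | phi in [set phi | P `<=` sat phi] &
                                   psi in [set psi | Q `<=` sat psi]].
have sXYY : small K (X + (Y + Y)).
  by do ?apply: small_sum => //; apply: monster_nat mM.
have [||e eP] := compact_directed mM (Sigma := Sigma) sXYY.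
- split=> [|_ _ [phi Pphi [psi Qpsi <-]] [phi' Pphi' [psi' Qpsi' <-]]].
    by exists (clash (Top _ _) (Top _ _)), (Top _ _) => //; exists (Top _ _).
  exists (clash (And phi phi') (And psi psi')).
    exists (And phi phi') => [b Pb|].
      by split; [apply: Pphi|apply: Pphi'].
    by exists (And psi psi') => // b Qb; split; [apply: Qpsi|apply: Qpsi'].
  move=> e; have [x [y1 [y2 ->]]] := clash_env e.
  by move=> /sat_clash[[? ?] [? ?] [? ?]]; split; apply/sat_clash.
- move=> _ [phi Pphi [psi Qpsi <-]]; apply: contrapT => unsat; apply: all_sat.
  by exists phi, psi; split=> // e sat_e; apply: unsat; exists e.
have [x [y1 [y2 ee]]] := clash_env e.
have clash_e (phi : formula L (sum_sort sx sy)) psi :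
    P `<=` sat phi -> Q `<=` sat psi ->
    [/\ sat psi (sum_env y1 y2), sat phi (sum_env x y1)
      & sat phi (sum_env x y2)].
  move=> Pphi Qpsi; apply/sat_clash; rewrite -ee.
  by apply: eP; exists phi => //; exists psi.
apply: (PQ x y1 y2); split; [apply: cQ => psi Qpsi|apply: cP => phi Pphi..].
- by have [] := clash_e (Top _ _) psi (fun _ _ => I) Qpsi.
- by have [] := clash_e phi (Top _ _) Pphi (fun _ _ => I).
- by have [] := clash_e phi (Top _ _) Pphi (fun _ _ => I).
Qed.

Lemma SOP1_tree_of_type_definable K (T : theory L) (M : structure L)
    (P : set (env M (sum_sort sx sy))) (Q : set (env M (sum_sort sy sy)))
    (a : seq bool -> env M sy) :
  monster K T M -> small K X -> small K Y ->
  type_definable P -> type_definable Q ->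
  SOP1_tree P Q a ->
  exists (phi : formula L (sum_sort sx sy)) (psi : formula L (sum_sort sy sy)),
    SOP1_tree (sat phi) (sat psi) a.
Proof.
move=> mM sX sY cP cQ [branch PQ path].
have [phi [psi [Pphi Qpsi unsat]]] := unsat_clash mM sX sY cP cQ PQ.
exists phi, psi; split.
- by move=> sigma; have [b bP] := branch sigma; exists b => k; apply/Pphi/bP.
- by move=> x y1 y2 /sat_clash; apply: unsat.
- by move=> eta nu /path/Qpsi.
Qed.

End Clash.

Lemma SOP1_tree_finite (M : structure L) X Y (sx : X -> S) (sy : Y -> S)
    (phi : formula L (sum_sort sx sy)) (psi : formula L (sum_sort sy sy))
    (a : seq bool -> env M sy) :
  SOP1_tree (sat phi) (sat psi) a ->
  exists n m (fx : 'I_n -> X) (fy : 'I_m -> Y)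
    (phi' : formula L (sum_sort (fun i => sx (fx i)) (fun i => sy (fy i))))
    (psi' : formula L (sum_sort (fun i => sy (fy i)) (fun i => sy (fy i)))),
    SOP1_tree (sat phi') (sat psi') (fun eta i => a eta (fy i)).
Proof.
move=> [branch unsat path].
have finite_inl V W (s : V + W -> S) (chi : formula L s) :
    finite_set (inl @^-1` vars chi).
  exact: finite_preimage (in2W inl_inj) (finite_vars chi).
have finite_inr V W (s : V + W -> S) (chi : formula L s) :
    finite_set (inr @^-1` vars chi).
  exact: finite_preimage (in2W inr_inj) (finite_vars chi).
have [n [fx [fxI fxP]]] := finite_set_range (finite_inl _ _ _ phi).
have [|m [fy [fyI]]] := @finite_set_range _ (inr @^-1` vars phi `|`
    (inl @^-1` vars psi `|` inr @^-1` vars psi)).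
  by rewrite !finite_setU.
rewrite !subUset => -[fy_phi [fy_psi1 fy_psi2]].
have [phi' phi'P] := restrict_sum_vars fxP fy_phi.
have [psi' psi'P] := restrict_sum_vars fy_psi1 fy_psi2.
exists n, m, fx, fy, phi', psi'; split.
- move=> sigma; have [b bP] := branch sigma.
  by exists (fun i => b (fx i)) => k; apply/phi'P.
- move=> x y1 y2; have [x' <-] := env_extend x fxI.
  have [y1' <-] := env_extend y1 fyI; have [y2' <-] := env_extend y2 fyI.
  by move=> [/psi'P psi12 /phi'P phi1 /phi'P phi2]; apply: (unsat x' y1' y2').
- by move=> eta nu /path psia; apply/psi'P.
Qed.

Definition sat_universal (T : theory L) (M : structure L) : Prop :=
  forall N : structure L, is_model T N ->
  forall V (s : V -> S) (phi : formula L s) (a : env N s), sat phi a ->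
  exists b : env M s, sat phi b.

Lemma NSOP1_tree (T : theory L) (M : structure L) :
  is_model T M -> sat_universal T M ->
  NSOP1 T M <-> forall n m (sx : 'I_n -> S) (sy : 'I_m -> S)
    (phi : formula L (sum_sort sx sy)) psi (a : seq bool -> env M sy),
    ~ SOP1_tree (sat phi) (sat psi) a.
Proof.
move=> MT uM; split=> nsop n m sx sy phi.
  move=> psi a [branch unsat path]; apply: (nsop n m sx sy phi).
  exists psi, a; split=> // N NT y1 y2 [psi12 [x [phi1 phi2]]].
  have /(uM N NT)[e] : sat (clash phi psi) (sum_env x (sum_env y1 y2)).
    exact/sat_clash.
  by have [x' [z1 [z2 ->]]] := clash_env e; move=> /sat_clash; apply: unsat.
move=> [psi [a [branch unsat path]]]; apply: (nsop n m sx sy phi psi a).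
split=> // x y1 y2 [psi12 phi1 phi2].
by apply: (unsat M MT y1 y2); split=> //; exists x.
Qed.

Lemma sat_universal_Th (M : structure L) :
  sat_universal [set chi | holds M chi] M.
Proof.
move=> N NM V s phi a phia; apply: contrapT => unsat.
have [chi chiP] := ex_closure phi; have [e] := @env_inhabited _ _ N _ no_sort.
suff /NM/(_ e) : holds M (HSentence chi (Bot L no_sort)).
  by apply; apply/chiP; exists a.
by move=> e' /= /chiP.
Qed.

Lemma sat_universal_JEP (T : theory L) (M : structure L) :
  JEP T -> existentially_closed T M -> sat_universal T M.
Proof.
move=> jep [MT ec] N NT V s phi a phia.
have [N' [h1 [h2 [N'T hom1 hom2]]]] := jep N M NT MT.
have [_ imm] := ec _ _ N'T hom2.
have [chi chiP] := ex_closure phi; have [e] := @env_inhabited _ _ M _ no_sort.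
apply/(chiP M e)/imm/chiP; exists (fun v => h1 _ (a v)); exact: sat_hom.
Qed.

End SOP1.

(** * Hyperimaginaries as classes of real tuples *)

Section Representatives.
Context {L : signature unit} {M : structure L} {J : Type} {len : J -> Type}
  (E : forall j, set (formula L (sum_sort (real (len j)) (real (len j))))).

Let HL := hyp_signature L len.
Let HM := hyp_structure M E.

(* The coordinates of a representative of an element of sort t *)
Definition place (t : unit + J) : Type :=
  match t with inl _ => unit | inr j => len j end.

Definition place_sort (t : unit + J) : unit :=
  match t with inl u => u | inr _ => tt end.

Definition to_hyp (t : unit + J) : (place t -> M (place_sort t)) -> HM t :=
  match t with
  | inl u => fun c => c tt
  | inr j => fun c => exist _ [set b | Erel M E j c b] (ex_intro _ c erefl)
  end.

Lemma to_hyp_surj t (c : HM t) : exists b, to_hyp b = c.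
Proof.
case: t c => [u|j] c; first by exists (fun=> c).
by case: c => c [b e]; exists b; apply: eq_exist.
Qed.

Definition places {V : Type} (s : V -> unit + J) : Type :=
  {v : V & place (s v)}.

Definition places_sort {V : Type} (s : V -> unit + J) (q : places s) : unit :=
  place_sort (s (tag q)).
Arguments places_sort {V} s q.

Definition hyp_env {V : Type} {s : V -> unit + J} (c : env M (places_sort s)) :
    env HM s :=
  fun v => to_hyp (fun p => c (existT _ v p)).

Lemma hyp_env_surj V (s : V -> unit + J) (b : env HM s) :
  exists c, hyp_env c = b.
Proof.
pose c v := cid (to_hyp_surj (b v)).
exists (fun q => sval (c (tag q)) (tagged q)).
by apply: functional_extensionality_dep => v; rewrite -[RHS](svalP (c v)).
Qed.

Definition hyp_term_map {V W : Type} {s : V -> unit + J} {w : W -> unit}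
    (h : env M w -> env HM s) : Prop :=
  forall v, exists f : place (s v) -> term L w (place_sort (s v)),
  forall a, h a v = to_hyp (fun p => eval a (f p)).

Lemma hyp_term_map_eval V W (s : V -> unit + J) (w : W -> unit)
    (h : env M w -> env HM s) t (u : term HL s t) :
  hyp_term_map h ->
  exists f : place t -> term L w (place_sort t),
  forall a, eval (h a) u = to_hyp (fun p => eval a (f p)).
Proof.
move=> hT; elim: u => [v|g args IH]; first exact: hT.
pose f i := sval (cid (IH i)) tt.
exists (fun=> @App _ L _ w g f) => a /=.
by apply: eq_fint => i; exact: (svalP (cid (IH i)) a).
Qed.

Lemma hyp_term_map_ext V W (s : V -> unit + J) (w : W -> unit) t
    (h : env M w -> env HM s) :
  hyp_term_map h ->
  hyp_term_map (fun e : env M (sum_sort (fun _ : place t => place_sort t) w) =>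
    ext_env (h (fun x => e (inr x))) (to_hyp (fun p => e (inl p)))).
Proof.
move=> hT; pose tw := sum_sort (fun _ : place t => place_sort t) w.
move=> [v|]; last by exists (fun p => Var L tw (inl p)).
have [f hE] := hT v.
exists (fun p => term_subst (f p) (fun x _ => Var L tw (inr x))) => e /=.
rewrite hE; congr to_hyp; apply: functional_extensionality_dep => p.
by rewrite (eval_subst (b := fun x => e (inr x))).
Qed.

Lemma type_definable_Erel j :
  type_definable [set a : env M (sum_sort (real (len j)) (real (len j))) |
    Erel M E j (fun p => a (inl p)) (fun p => a (inr p))].
Proof. by exists (E (j := j)) => a; rewrite /Erel /= sum_env_eta. Qed.

Context {K : Type} {T : theory L} (mM : monster K T M)
  (slen : forall j, small K (len j)).

Lemma small_place t : small K (place t).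
Proof. by case: t => [u|j] //=; apply: small_countType (monster_nat mM) _. Qed.

Lemma small_places n (s : 'I_n -> unit + J) : small K (places s).
Proof.
by apply: small_tag_ord => [|i]; [exact: monster_nat mM|exact: small_place].
Qed.

Lemma type_definable_hyp_rint (R : hyp_rsym L len) :
  type_definable [set a : env M (sum_sort (real 'I_(hr_real R))
      (real {k : 'I_(hr_num R) & len (hr_type k)})) |
    hyp_rint (E := E) (R := R) (fun i => a (inl i))
      (fun k => @to_hyp (inr (hr_type k)) (fun p => a (inr (existT _ k p))))].
Proof.
pose I := 'I_(hr_real R); pose U := {k : 'I_(hr_num R) & len (hr_type k)}.
pose IU := sum_sort (real I) (real U); pose UIU := sum_sort (real U) IU.
pose P := [set e : env M UIU |
  (forall k, Erel M E (hr_type k) (fun p => e (inr (inr (existT _ k p))))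
                                  (fun p => e (inl (existT _ k p)))) /\
  sat (hr_formula R) (sum_env (fun i => e (inr (inl i))) (fun q => e (inl q)))].
have tdP : type_definable P.
  apply: type_definableI.
    apply: type_definable_forall => k.
    apply: (type_definable_preimage (g := fun e => sum_env
      (fun p => e (inr (inr (existT _ k p))))
      (fun p => e (inl (existT _ k p)))) _ (type_definable_Erel (hr_type k))).
    by move=> [p|p]; [exists (Var L UIU (inr (inr (existT _ k p))))
      |exists (Var L UIU (inl (existT _ k p)))].
  apply: (type_definable_preimage (g := fun e => sum_env
    (fun i => e (inr (inl i))) (fun q => e (inl q))) _
    (type_definable_sat (hr_formula R))).
  by move=> [i|q]; [exists (Var L UIU (inr (inl i)))
    |exists (Var L UIU (inl q))].
have natK := monster_nat mM.
have sU : small K U by exact: small_tag_ord.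
have sIU : small K (I + U) := small_sum natK (small_countType natK I) sU.
apply: eq_type_definable (type_definable_ex mM sU sIU tdP) => a /=.
split=> [[c [Ec Rc]]|[b [Eb Rb]]].
  exists (fun k p => c (existT _ k p)); split=> //.
  by apply: (eq_sat _ _).1 Rc => -[|[]].
by exists (fun q => b (tag q) (tagged q)).
Qed.

Context (eqE : forall j, RelationClasses.Equivalence (Erel M E j)).

Lemma to_hyp_eq j (b c : place (inr j) -> M tt) :
  @to_hyp (inr j) b = @to_hyp (inr j) c <-> Erel M E j b c.
Proof.
have [rE sE tE] := eqE j.
split=> [/(congr1 sval) /= bc|bc].
  by rewrite -[Erel _ _ _ _ _]/([set c' | Erel M E j b c'] c) bc; apply: rE.
apply: eq_exist; apply/seteqP; split=> d /=; apply: tE => //.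
exact: sE.
Qed.

Section Pullback.
Context {V W : Type} {s : V -> unit + J} {w : W -> unit}
  {h : env M w -> env HM s} (hT : hyp_term_map h).

Lemma type_definable_real_rel r
    (args : forall i : rarity HL (inl r), term HL s (@rdom _ HL (inl r) i)) :
  type_definable [set a | sat (Rel args) (h a)].
Proof.
pose f i := cid (hyp_term_map_eval (args i) hT).
apply: eq_type_definable
  (type_definable_sat (@Rel _ L _ w r (fun i => sval (f i) tt))).
by move=> a; apply: eq_rint => i; rewrite (svalP (f i)).
Qed.

Lemma type_definable_hyp_rel (R : hyp_rsym L len)
    (args : forall i : rarity HL (inr R), term HL s (@rdom _ HL (inr R) i)) :
  type_definable [set a | sat (Rel args) (h a)].
Proof.
pose x i := cid (hyp_term_map_eval (args (inl i)) hT).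
pose y k := cid (hyp_term_map_eval (args (inr k)) hT).
apply: eq_type_definable (type_definable_preimage (g := fun a => sum_env
  (fun i => eval a (sval (x i) tt))
  (fun q : {k & len (hr_type k)} => eval a (sval (y (tag q)) (tagged q))))
  _ (type_definable_hyp_rint R)) => [a|[i|q]] /=.
- rewrite (_ : (fun i => eval (h a) (args (inl i))) =
      fun i => eval a (sval (x i) tt)); last first.
    by apply: functional_extensionality_dep => i; rewrite (svalP (x i)).
  rewrite (_ : (fun k => eval (h a) (args (inr k))) =
      fun k => to_hyp (fun p => eval a (sval (y k) p))) //.
  by apply: functional_extensionality_dep => k; rewrite (svalP (y k)).
- by exists (sval (x i) tt).
- by exists (sval (y (tag q)) (tagged q)).
Qed.

Lemma type_definable_hyp_eq t (t1 t2 : term HL s t) :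
  type_definable [set a | eval (h a) t1 = eval (h a) t2].
Proof.
have [f1 f1E] := hyp_term_map_eval t1 hT.
have [f2 f2E] := hyp_term_map_eval t2 hT.
case: t t1 t2 f1 f1E f2 f2E => [u|j] t1 t2 f1 f1E f2 f2E.
  apply: eq_type_definable (type_definable_sat (Eq (f1 tt) (f2 tt))).
  by move=> a /=; rewrite f1E f2E.
apply: eq_type_definable (type_definable_preimage (g := fun a => sum_env
  (fun p => eval a (f1 p)) (fun p => eval a (f2 p)))
  _ (type_definable_Erel j)) => [a|[p|p]] /=.
- by rewrite f1E f2E to_hyp_eq.
- by exists (f1 p).
- by exists (f2 p).
Qed.

End Pullback.

Lemma type_definable_hyp_sat V W (s : V -> unit + J) (w : W -> unit)
    (phi : formula HL s) (h : env M w -> env HM s) :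
  small K W -> hyp_term_map h -> type_definable [set a | sat phi (h a)].
Proof.
elim: phi W w h => {V s} [V s [r|R] args|V s t t1 t2|V s|V s|V s p IHp q IHq
  |V s p IHp q IHq|V s t p IHp] W w h sW hT.
- exact: type_definable_real_rel.
- exact: type_definable_hyp_rel.
- exact: type_definable_hyp_eq.
- exact: (type_definable_sat (Top L w)).
- exact: (type_definable_sat (Bot L w)).
- exact: type_definableI (IHp _ _ _ sW hT) (IHq _ _ _ sW hT).
- exact: type_definableU (IHp _ _ _ sW hT) (IHq _ _ _ sW hT).
have st := small_place t; have stW := small_sum (monster_nat mM) st sW.
have td_p := type_definable_ex mM st sW (IHp _ _ _ stW (hyp_term_map_ext t hT)).
apply: eq_type_definable td_p => a /=.
split=> [[d pd]|[x]]; first by exists (to_hyp d).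
by have [d <-] := to_hyp_surj x; exists d.
Qed.

Lemma SOP1_tree_representatives n m
    (sx : 'I_n -> unit + J) (sy : 'I_m -> unit + J)
    (phi : formula HL (sum_sort sx sy)) psi (a : seq bool -> env HM sy) :
  SOP1_tree (sat phi) (sat psi) a ->
  exists n' m' (sx' : 'I_n' -> unit) (sy' : 'I_m' -> unit)
    (phi' : formula L (sum_sort sx' sy')) psi' (a' : seq bool -> env M sy'),
    SOP1_tree (sat phi') (sat psi') a'.
Proof.
move=> [branch unsat path].
have /choice[d dE] eta : exists c, hyp_env c = a eta by exact: hyp_env_surj.
pose hyp_pair k l (s : 'I_k -> unit + J) (t : 'I_l -> unit + J)
  (e : env M (sum_sort (places_sort s) (places_sort t))) :=
  sum_env (hyp_env (fun q => e (inl q))) (hyp_env (fun q => e (inr q))).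
have td_pair k l (s : 'I_k -> unit + J) (t : 'I_l -> unit + J)
    (chi : formula HL (sum_sort s t)) :
    type_definable [set e | sat chi (hyp_pair k l s t e)].
  apply: type_definable_hyp_sat; first exact:
    (small_sum (monster_nat mM) (small_places s) (small_places t)).
  pose st := sum_sort (places_sort s) (places_sort t).
  by move=> [v|v]; [exists (fun p => Var L st (inl (existT _ v p)))
    |exists (fun p => Var L st (inr (existT _ v p)))].
have tree : SOP1_tree [set e | sat phi (hyp_pair _ _ _ _ e)]
    [set e | sat psi (hyp_pair _ _ _ _ e)] d.
  split=> [sigma|x y1 y2|eta nu /path]; [|exact: unsat|by rewrite -!dE].
  have [b bP] := branch sigma; have [c cb] := hyp_env_surj b.
  by exists c => k; rewrite /hyp_pair /= cb dE.
have [phi0 [psi0 /SOP1_tree_finite]] :=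
  SOP1_tree_of_type_definable mM (small_places sx) (small_places sy)
    (td_pair _ _ _ _ phi) (td_pair _ _ _ _ psi) tree.
move=> [n' [m' [fx [fy [phi' [psi' tree']]]]]].
by exists n', m', _, _, phi', psi', (fun eta i => d eta (fy i)).
Qed.

End Representatives.

(** * Real formulas in the hyperimaginary extension *)

Section RealFormulas.
Context {L : signature unit} {J : Type} {len : J -> Type}.

Let HL := hyp_signature L len.

Fixpoint hyp_term {V : Type} {s : V -> unit} {t : unit} (u : term L s t) :
    term HL (fun v => inl (s v)) (inl t) :=
  match u with
  | Var v => Var HL (fun v => inl (s v)) v
  | App g args => @App _ HL _ _ g (fun i => hyp_term (args i))
  end.

Fixpoint hyp_formula {V : Type} {s : V -> unit} (phi : formula L s) :
    formula HL (fun v => inl (s v)) :=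
  match phi with
  | Rel r args => @Rel _ HL _ _ (inl r) (fun i => hyp_term (args i))
  | Eq t t1 t2 => Eq (hyp_term t1) (hyp_term t2)
  | Top => Top _ _
  | Bot => Bot _ _
  | And phi psi => And (hyp_formula phi) (hyp_formula psi)
  | Or phi psi => Or (hyp_formula phi) (hyp_formula psi)
  | Ex t phi => Ex (subst (hyp_formula phi) (fun u _ => match u with
      | Some v => Var HL (ext_sort (fun v => inl (s v)) (inl t)) (Some v)
      | None => Var HL (ext_sort (fun v => inl (s v)) (inl t)) None
      end))
  end.

Definition hyp_formula_sum {V W : Type} {s : V -> unit} {t : W -> unit}
    (phi : formula L (sum_sort s t)) :
    formula HL (sum_sort (fun v => inl (s v)) (fun w => inl (t w))) :=
  let st := sum_sort (fun v => inl (s v)) (fun w => inl (t w)) in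
  subst (hyp_formula phi) (fun u _ => match u with
    | inl v => Var HL st (inl v)
    | inr w => Var HL st (inr w)
    end).

Context {M : structure L}
  (E : forall j, set (formula L (sum_sort (real (len j)) (real (len j))))).

Let HM := hyp_structure M E.

Lemma eval_hyp_term V (s : V -> unit) t (u : term L s t) (a : env M s) :
  eval (M := HM) (s := fun v => inl (s v)) a (hyp_term u) = eval a u.
Proof. by elim: u => //= g args IH; apply: eq_fint. Qed.

Lemma sat_hyp_formula V (s : V -> unit) (phi : formula L s) (a : env M s) :
  sat (M := HM) (s := fun v => inl (s v)) (hyp_formula phi) a <-> sat phi a.
Proof.
elim: phi a => {V s} [V s r args|V s t t1 t2|V s|V s|V s p IHp q IHq
  |V s p IHp q IHq|V s t p IHp] a //=.
- by apply: eq_rint => i; rewrite eval_hyp_term.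
- by rewrite !eval_hyp_term.
- by rewrite IHp IHq.
- by rewrite IHp IHq.
- split=> -[x px]; exists x; [apply/IHp; apply: (sat_subst _).1 px => -[] //|].
  by apply: (sat_subst _).2 ((IHp _).2 px) => -[].
Qed.

Lemma sat_hyp_formula_sum V W (s : V -> unit) (t : W -> unit)
    (phi : formula L (sum_sort s t)) (a : env M s) (b : env M t) :
  sat (M := HM) (hyp_formula_sum phi)
    (sum_env (M := HM) (s := fun v => inl (s v)) (t := fun w => inl (t w))
      a b) <->
  sat phi (sum_env a b).
Proof.
apply: iff_trans (sat_hyp_formula _ (sum_env a b)).
by apply: sat_subst => -[].
Qed.

Lemma SOP1_tree_hyp V W (s : V -> unit) (t : W -> unit)
    (phi : formula L (sum_sort s t)) (psi : formula L (sum_sort t t))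
    (a : seq bool -> env M t) :
  SOP1_tree (sat phi) (sat psi) a ->
  SOP1_tree (M := HM) (sx := fun v => inl (s v)) (sy := fun w => inl (t w))
    (sat (hyp_formula_sum phi)) (sat (hyp_formula_sum psi)) a.
Proof.
move=> [branch unsat path]; split.
- move=> sigma; have [b bP] := branch sigma.
  by exists b => k; apply/sat_hyp_formula_sum.
- move=> x y1 y2 [/sat_hyp_formula_sum psi12 /sat_hyp_formula_sum phi1].
  by move=> /sat_hyp_formula_sum phi2; apply: (unsat x y1 y2).
- by move=> eta nu /path psia; apply/sat_hyp_formula_sum.
Qed.

End RealFormulas.

Theorem theorem10p18 (K : Type) (L : signature unit) (T : theory L)
  (M : structure L) (J : Type) (len : J -> Type)
  (E : forall j : J, set (formula L (sum_sort (real (len j)) (real (len j))))) :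
  JEP T ->
  monster K T M ->
  (forall j : J, small K (len j)) ->
  (forall j : J, RelationClasses.Equivalence (Erel M E j)) ->
  NSOP1 T M <-> NSOP1 (hyp_theory M E) (hyp_structure M E).
Proof.
move=> jep mM slen eqE; have ecM := monster_ec mM.
rewrite (NSOP1_tree ecM.1 (sat_universal_JEP jep ecM)).
have univ_hyp := @sat_universal_Th _ _ (hyp_structure M E).
rewrite (NSOP1_tree (T := hyp_theory M E) _ univ_hyp) //.
split=> noTree n m sx sy phi psi a tree.
- have [n' [m' [sx' [sy' [phi' [psi' [a' tree']]]]]]] :=
    SOP1_tree_representatives mM slen eqE tree.
  exact: noTree tree'.
- exact: noTree (SOP1_tree_hyp E tree).
Qed.
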